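(* Let $T \supseteq S^1_2$ be a sound first-order $L$-theory with a polynomial-time decidable set of axioms, and let $g_T$ be the function defined in the context. Let $A\subseteq\{0,1\}^*$ be an infinite set definable in $\mathbf N$ by an $L$-formula, and assume that for some $L$-formula $\Phi(x)$ with one free variable defining $A$ (i.e. $A=\{x : \mathbf N\models\Phi(x)\}$), the theory $T$ proves every sentence $\Phi^w$, $w\in\{0,1\}^{c}$ with $c=|\Phi|+1$, that is true in $\mathbf N$. Then $Rng(g_T)\cap A\neq\emptyset$.
   Context: $S^1_2$ is Buss's theory of bounded arithmetic, with language $L$ interpreted canonically in the standard model $\mathbf N$; binary strings are identified with natural numbers in the standard way. Sound means all axioms of $T$ are true in $\mathbf N$. $L$-formulas are identified with binary strings encoding them (a fixed natural encoding in which no formula is a proper prefix of another); $|\Psi|$ is the length of the code. For strings $u,v$, $uv$ denotes concatenation and $u\subseteq_e v$ means $u$ is a prefix of $v$. The size of a $T$-proof is the length of its binary code. For an $L$-formula $\Phi(x)$ with one free variable and $w\in\{0,1\}^*$, $\Phi^w$ denotes the sentence $\exists y\,\forall x>y\,(\Phi(x)\rightarrow \neg(w\subseteq_e x))$. $\overline 0$ denotes the all-zero string. The function $g_T$ is defined as follows on input $u$ with $|u|=n$: (1) Find an $L$-formula $\Phi$ with one free variable $x$ such that $\Phi\subseteq_e u$ and $|\Phi|\le \log n$ (unique if it exists). If none exists, output $\overline 0\in\{0,1\}^{n+1}$. (2) Otherwise put $c:=|\Phi|+1$ and, going through all $w\in\{0,1\}^c$ in lexicographic order, search for a $T$-proof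 of size $\le\log n$ of $\Phi^w$. If such a proof is found for every $w$, output $\overline 0\in\{0,1\}^{n+1}$. Otherwise let $w_0$ be the lexicographically first $w\in\{0,1\}^c$ for which no such proof is found. (3) Writing $u=\Phi u_0$, output $g_T(u):=w_0u_0\in\{0,1\}^{n+1}$. *)

(* Defs.v *)
From HB Require Import structures.
From mathcomp Require Import all_boot.
From mathcomp Require Import boolp classical_sets cardinality.

Set Implicit Arguments.
Unset Strict Implicit.
Unset Printing Implicit Defensive.

Local Open Scope classical_set_scope.
Local Open Scope nat_scope.

(* Buss's language: [Half x], [Len x] and [Smash x y] are the floor of x/2,
   |x| and x # y = 2^(|x| |y|). *)
Inductive term : Type :=
| Var of nat
| Zero
| Succ of term
| Half of term
| Len of term
| Add of term & term
| Mul of term & term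
| Smash of term & term.

Inductive formula : Type :=
| Eq of term & term
| Le of term & term
| Not of formula
| Imp of formula & formula
| And of formula & formula
| Or of formula & formula
| All of nat & formula
| Ex of nat & formula.

Lemma term_eq_dec : comparable term.
Proof. by move=> s t; rewrite /decidable; decide equality; apply: eq_comparable. Qed.
HB.instance Definition _ := hasDecEq.Build term (compareP term_eq_dec).

Lemma formula_eq_dec : comparable formula.
Proof. by move=> p q; rewrite /decidable; decide equality; apply: eq_comparable. Qed.
HB.instance Definition _ := hasDecEq.Build formula (compareP formula_eq_dec).

Declare Scope tm_scope.
Delimit Scope tm_scope with tm.
Bind Scope tm_scope with term.
Declare Scope fm_scope.
Delimit Scope fm_scope with fm.
Bind Scope fm_scope with formula.

Notation "s + t" := (Add s t) : tm_scope.
Notation "s * t" := (Mul s t) : tm_scope.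
Notation "s ## t" := (Smash s t) (at level 40, left associativity) : tm_scope.
Notation "s == t" := (Eq s%tm t%tm) : fm_scope.
Notation "s != t" := (Not (Eq s%tm t%tm)) : fm_scope.
Notation "s <= t" := (Le s%tm t%tm) : fm_scope.
Notation "s < t" := (Le (Succ s%tm) t%tm) : fm_scope.
Notation "~~ p" := (Not p) : fm_scope.
Notation "p ==> q" := (Imp p q) : fm_scope.
Notation "p && q" := (And p q) : fm_scope.
Notation "p || q" := (Or p q) : fm_scope.
Notation "p <==> q" := (And (Imp p q) (Imp q p))
  (at level 60, no associativity) : fm_scope.

Definition One : term := Succ Zero.
Definition Two : term := Succ (Succ Zero).

Definition BAll (x : nat) (t : term) (p : formula) : formula :=
  All x ((Var x <= t) ==> p)%fm.
Definition BEx (x : nat) (t : term) (p : formula) : formula :=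
  Ex x ((Var x <= t) && p)%fm.

Fixpoint tvars (t : term) : seq nat :=
  match t with
  | Var i => [:: i]
  | Zero => [::]
  | Succ s | Half s | Len s => tvars s
  | Add s1 s2 | Mul s1 s2 | Smash s1 s2 => tvars s1 ++ tvars s2
  end.

Fixpoint fvars (p : formula) : seq nat :=
  match p with
  | Eq s t | Le s t => tvars s ++ tvars t
  | Not q => fvars q
  | Imp q r | And q r | Or q r => fvars q ++ fvars r
  | All x q | Ex x q => [seq y <- fvars q | y != x]
  end.

Fixpoint tsubst (x : nat) (t s : term) : term :=
  match s with
  | Var i => if i == x then t else Var i
  | Zero => Zero
  | Succ s1 => Succ (tsubst x t s1)
  | Half s1 => Half (tsubst x t s1)
  | Len s1 => Len (tsubst x t s1)
  | Add s1 s2 => Add (tsubst x t s1) (tsubst x t s2)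
  | Mul s1 s2 => Mul (tsubst x t s1) (tsubst x t s2)
  | Smash s1 s2 => Smash (tsubst x t s1) (tsubst x t s2)
  end.

(* No renaming of bound variables: capture is excluded by [free_for] below. *)
Fixpoint fsubst (x : nat) (t : term) (p : formula) : formula :=
  match p with
  | Eq s1 s2 => Eq (tsubst x t s1) (tsubst x t s2)
  | Le s1 s2 => Le (tsubst x t s1) (tsubst x t s2)
  | Not q => Not (fsubst x t q)
  | Imp q r => Imp (fsubst x t q) (fsubst x t r)
  | And q r => And (fsubst x t q) (fsubst x t r)
  | Or q r => Or (fsubst x t q) (fsubst x t r)
  | All y q => if y == x then All y q else All y (fsubst x t q)
  | Ex y q => if y == x then Ex y q else Ex y (fsubst x t q)
  end.

(* [free_for t x p]: no free occurrence of x in p lies in the scope of a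
   quantifier binding a variable of t. *)
Fixpoint free_for (t : term) (x : nat) (p : formula) : bool :=
  match p with
  | Eq _ _ | Le _ _ => true
  | Not q => free_for t x q
  | Imp q r | And q r | Or q r => free_for t x q && free_for t x r
  | All y q | Ex y q =>
      (x \notin fvars p) || (y \notin tvars t) && free_for t x q
  end.

(* Buss's |x| is the length of the binary representation of x, that is
   ceil (log2 (x + 1)), with |0| = 0. *)
Definition blen (n : nat) : nat := up_log 2 n.+1.

Definition upd (e : nat -> nat) (x n : nat) : nat -> nat :=
  fun y => if y == x then n else e y.

Fixpoint eval (e : nat -> nat) (t : term) : nat :=
  match t with
  | Var i => e i
  | Zero => 0
  | Succ s => (eval e s).+1
  | Half s => (eval e s)./2
  | Len s => blen (eval e s)
  | Add s1 s2 => eval e s1 + eval e s2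
  | Mul s1 s2 => eval e s1 * eval e s2
  | Smash s1 s2 => 2 ^ (blen (eval e s1) * blen (eval e s2))
  end.

Fixpoint sat (e : nat -> nat) (p : formula) : Prop :=
  match p with
  | Eq s t => eval e s = eval e t
  | Le s t => eval e s <= eval e t
  | Not q => ~ sat e q
  | Imp q r => sat e q -> sat e r
  | And q r => sat e q /\ sat e r
  | Or q r => sat e q \/ sat e r
  | All x q => forall n, sat (upd e x n) q
  | Ex x q => exists n, sat (upd e x n) q
  end.

(* Formulas with free variables are read as their universal closures. *)
Definition true_in_N (p : formula) : Prop := forall e, sat e p.

(* Together with the rules of [justified]: Kleene's Hilbert-style calculus. *)
Inductive logical_axiom : formula -> Prop :=
| LK p q : logical_axiom (p ==> (q ==> p))%fm
| LS p q r : logical_axiom ((p ==> (q ==> r)) ==> ((p ==> q) ==> (p ==> r)))%fm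
| LAndI p q : logical_axiom (p ==> (q ==> p && q))%fm
| LAndL p q : logical_axiom (p && q ==> p)%fm
| LAndR p q : logical_axiom (p && q ==> q)%fm
| LOrL p q : logical_axiom (p ==> p || q)%fm
| LOrR p q : logical_axiom (q ==> p || q)%fm
| LOrE p q r : logical_axiom ((p ==> r) ==> ((q ==> r) ==> (p || q ==> r)))%fm
| LNotI p q : logical_axiom ((p ==> q) ==> ((p ==> ~~ q) ==> ~~ p))%fm
| LNotE p : logical_axiom (~~ ~~ p ==> p)%fm
| LAllE x t p of free_for t x p : logical_axiom (All x p ==> fsubst x t p)%fm
| LExI x t p of free_for t x p : logical_axiom (fsubst x t p ==> Ex x p)%fm
| LEqRefl t : logical_axiom (t == t)%fm
| LEqSubst x s t p of free_for s x p & free_for t x p :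
    logical_axiom ((s == t) ==> (fsubst x s p ==> fsubst x t p))%fm.

(* [justified T prev p]: the line p may follow the lines prev in a T-proof. *)
Inductive justified (T : set formula) (prev : seq formula) : formula -> Prop :=
| JLogic p of logical_axiom p : justified T prev p
| JAxiom p of T p : justified T prev p
| JMP q p of q \in prev & Imp q p \in prev : justified T prev p
| JAllI x q p of x \notin fvars q & Imp q p \in prev :
    justified T prev (q ==> All x p)%fm
| JExE x q p of x \notin fvars q & Imp p q \in prev :
    justified T prev (Ex x p ==> q)%fm.

Inductive derivation (T : set formula) : seq formula -> Prop :=
| DNil : derivation T [::]
| DStep prev p of derivation T prev & justified T prev p :
    derivation T (rcons prev p).

Definition is_proof (T : set formula) (pi : seq formula) (p : formula) : Prop :=
  derivation T pi /\ exists prev, pi = rcons prev p.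

Definition provable (T : set formula) (p : formula) : Prop :=
  exists pi, is_proof T pi p.

Definition sound (T : set formula) : Prop := forall p, T p -> true_in_N p.

Definition BASIC : seq formula :=
  let x := Var 0 in let y := Var 1 in let z := Var 2 in
  let u := Var 3 in let v := Var 4 in
  [:: ((y <= x) ==> (y <= Succ x))%fm;
      (x != Succ x)%fm;
      (Zero <= x)%fm;
      ((x <= y) && (x != y) <==> (Succ x <= y))%fm;
      ((x != Zero) ==> (Two * x != Zero))%fm;
      ((y <= x) || (x <= y))%fm;
      ((x <= y) && (y <= x) ==> (x == y))%fm;
      ((x <= y) && (y <= z) ==> (x <= z))%fm;
      (Len Zero == Zero)%fm;
      ((x != Zero) ==> (Len (Two * x) == Succ (Len x))
                       && (Len (Succ (Two * x)) == Succ (Len x)))%fm;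
      (Len One == One)%fm;
      ((x <= y) ==> (Len x <= Len y))%fm;
      (Len (x ## y) == Succ (Len x * Len y))%fm;
      (Zero ## y == One)%fm;
      ((x != Zero) ==> (One ## (Two * x) == Two * (One ## x))
                       && (One ## Succ (Two * x) == Two * (One ## x)))%fm;
      (x ## y == y ## x)%fm;
      ((Len x == Len y) ==> (x ## z == y ## z))%fm;
      ((Len x == Len u + Len v) ==> (x ## y == (u ## y) * (v ## y)))%fm;
      (x <= x + y)%fm;
      ((x <= y) && (x != y) ==> (Succ (Two * x) <= Two * y)
                                && (Succ (Two * x) != Two * y))%fm;
      (x + y == y + x)%fm;
      (x + Zero == x)%fm;
      (x + Succ y == Succ (x + y))%fm;
      ((x + y) + z == x + (y + z))%fm;
      ((x + y <= x + z) <==> (y <= z))%fm;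
      (x * Zero == Zero)%fm;
      (x * Succ y == x * y + x)%fm;
      (x * y == y * x)%fm;
      (x * (y + z) == x * y + x * z)%fm;
      ((One <= x) ==> ((x * y <= x * z) <==> (y <= z)))%fm;
      ((x != Zero) ==> (Len x == Succ (Len (Half x))))%fm;
      ((x == Half y) <==> (Two * x == y) || (Succ (Two * x) == y))%fm].

(* The class Sigma^b_0 = Pi^b_0: every quantifier is sharply bounded. *)
Inductive Sigma0b : formula -> Prop :=
| S0Eq s t : Sigma0b (Eq s t)
| S0Le s t : Sigma0b (Le s t)
| S0Not p of Sigma0b p : Sigma0b (Not p)
| S0Imp p q of Sigma0b p & Sigma0b q : Sigma0b (Imp p q)
| S0And p q of Sigma0b p & Sigma0b q : Sigma0b (And p q)
| S0Or p q of Sigma0b p & Sigma0b q : Sigma0b (Or p q)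
| S0All x t p of x \notin tvars t & Sigma0b p : Sigma0b (BAll x (Len t) p)
| S0Ex x t p of x \notin tvars t & Sigma0b p : Sigma0b (BEx x (Len t) p).

Inductive Sigma1b : formula -> Prop :=
| S1Base p of Sigma0b p : Sigma1b p
| S1Not p of Pi1b p : Sigma1b (Not p)
| S1Imp p q of Pi1b p & Sigma1b q : Sigma1b (Imp p q)
| S1And p q of Sigma1b p & Sigma1b q : Sigma1b (And p q)
| S1Or p q of Sigma1b p & Sigma1b q : Sigma1b (Or p q)
| S1All x t p of x \notin tvars t & Sigma1b p : Sigma1b (BAll x (Len t) p)
| S1Ex x t p of x \notin tvars t & Sigma1b p : Sigma1b (BEx x t p)
with Pi1b : formula -> Prop :=
| P1Base p of Sigma0b p : Pi1b p
| P1Not p of Sigma1b p : Pi1b (Not p)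
| P1Imp p q of Sigma1b p & Pi1b q : Pi1b (Imp p q)
| P1And p q of Pi1b p & Pi1b q : Pi1b (And p q)
| P1Or p q of Pi1b p & Pi1b q : Pi1b (Or p q)
| P1Ex x t p of x \notin tvars t & Pi1b p : Pi1b (BEx x (Len t) p)
| P1All x t p of x \notin tvars t & Pi1b p : Pi1b (BAll x t p).

(* [Half (Var x)] is always free for x in p, so the substitution is proper. *)
Definition PIND (x : nat) (p : formula) : formula :=
  (fsubst x Zero p && All x (fsubst x (Half (Var x)) p ==> p) ==> All x p)%fm.

Definition S12 : set formula :=
  [set p | p \in BASIC \/ exists x q, Sigma1b q /\ p = PIND x q].

(* Polish notation; a symbol takes four bits and the variable with index i is
   followed by i in unary, so that no code is a proper prefix of another. *)
Definition vcode (i : nat) : seq bool := rcons (nseq i true) false.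

Definition tok (a b c d : nat) : seq bool := [seq i != 0 | i <- [:: a; b; c; d]].

Fixpoint tcode (t : term) : seq bool :=
  match t with
  | Var i => tok 0 0 0 0 ++ vcode i
  | Zero => tok 0 0 0 1
  | Succ s => tok 0 0 1 0 ++ tcode s
  | Half s => tok 0 0 1 1 ++ tcode s
  | Len s => tok 0 1 0 0 ++ tcode s
  | Add s1 s2 => tok 0 1 0 1 ++ tcode s1 ++ tcode s2
  | Mul s1 s2 => tok 0 1 1 0 ++ tcode s1 ++ tcode s2
  | Smash s1 s2 => tok 0 1 1 1 ++ tcode s1 ++ tcode s2
  end.

Fixpoint code (p : formula) : seq bool :=
  match p with
  | Eq s t => tok 1 0 0 0 ++ tcode s ++ tcode t
  | Le s t => tok 1 0 0 1 ++ tcode s ++ tcode t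
  | Not q => tok 1 0 1 0 ++ code q
  | Imp q r => tok 1 0 1 1 ++ code q ++ code r
  | And q r => tok 1 1 0 0 ++ code q ++ code r
  | Or q r => tok 1 1 0 1 ++ code q ++ code r
  | All x q => tok 1 1 1 0 ++ vcode x ++ code q
  | Ex x q => tok 1 1 1 1 ++ vcode x ++ code q
  end.

Definition proof_code (pi : seq formula) : seq bool := flatten (map code pi).

Lemma vcode_inj i j u v : vcode i ++ u = vcode j ++ v -> i = j /\ u = v.
Proof.
elim: i j => [|i IH] [|j] //=; first by case.
by case=> /IH [-> ->].
Qed.

Lemma tcode_inj s t u v : tcode s ++ u = tcode t ++ v -> s = t /\ u = v.
Proof.
elim: s t u v => [i||s IH|s IH|s IH|s1 IH1 s2 IH2|s1 IH1 s2 IH2|s1 IH1 s2 IH2]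
  [j||t|t|t|t1 t2|t1 t2|t1 t2] u v //=.
- by case=> /vcode_inj [-> ->].
- by case.
- by case=> /IH [-> ->].
- by case=> /IH [-> ->].
- by case=> /IH [-> ->].
- by rewrite -!catA => -[/IH1 [-> /IH2 [-> ->]]].
- by rewrite -!catA => -[/IH1 [-> /IH2 [-> ->]]].
- by rewrite -!catA => -[/IH1 [-> /IH2 [-> ->]]].
Qed.

Lemma code_inj p q u v : code p ++ u = code q ++ v -> p = q /\ u = v.
Proof.
elim: p q u v =>
  [s t|s t|p IH|p1 IH1 p2 IH2|p1 IH1 p2 IH2|p1 IH1 p2 IH2|x p IH|x p IH]
  [s' t'|s' t'|q|q1 q2|q1 q2|q1 q2|y q|y q] u v //=.
- by rewrite -!catA => -[/tcode_inj [-> /tcode_inj [-> ->]]].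
- by rewrite -!catA => -[/tcode_inj [-> /tcode_inj [-> ->]]].
- by case=> /IH [-> ->].
- by rewrite -!catA => -[/IH1 [-> /IH2 [-> ->]]].
- by rewrite -!catA => -[/IH1 [-> /IH2 [-> ->]]].
- by rewrite -!catA => -[/IH1 [-> /IH2 [-> ->]]].
- by rewrite -!catA => -[/vcode_inj [-> /IH [-> ->]]].
- by rewrite -!catA => -[/vcode_inj [-> /IH [-> ->]]].
Qed.

Lemma code_prefix_free p q u : prefix (code p) u -> prefix (code q) u -> p = q.
Proof. by move=> /prefixP [v ->] /prefixP [w /code_inj []]. Qed.

(* Deterministic Turing machine with one two-way infinite tape. [None] is the
   blank, [Some (inl b)] the input bits, [Some (inr a)] the auxiliary letters.
   In [delta] the boolean is the move (true: right). The machine stops in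
   the states q with [verdict q = Some b], giving the answer b. *)
Record machine := Machine {
  state : finType;
  extra : finType;
  start : state;
  verdict : state -> option bool;
  delta : state -> option (bool + extra) ->
          state * option (bool + extra) * bool
}.

Definition letter (M : machine) : Type := option (bool + extra M).

(* State, tape to the left of the head (nearest cell first), and tape from the
   scanned cell on. Cells beyond the lists are blank. *)
Definition config (M : machine) : Type :=
  (state M * seq (letter M) * seq (letter M))%type.

Definition init_config (M : machine) (w : seq bool) : config M :=
  (start M, [::], [seq Some (inl b) | b <- w]).

Definition step (M : machine) (c : config M) : config M :=
  let: (q, l, r) := c in
  if verdict q is Some _ then c else
  let: (q', a, d) := delta q (head None r) in
  if d then (q', a :: l, behead r)
  else (q', behead l, head None l :: a :: behead r).

Definition ptime_decidable (L : set (seq bool)) : Prop :=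
  exists (M : machine) (k : nat), forall w : seq bool,
    let: (q, _, _) := iter (size w ^ k + k) (@step M) (init_config M w) in
    exists b : bool, verdict q = Some b /\ (b <-> L w).

(* The standard bijection {0,1}^* -> N: the binary representation of the
   number plus one is the string preceded by the digit 1. *)
Definition nat_of_str (w : seq bool) : nat :=
  foldl (fun n (b : bool) => (2 * n + b).+1) 0 w.

(* The closed term of size O(|w|) with value [nat_of_str w]. *)
Definition str_term (w : seq bool) : term :=
  foldl (fun t (b : bool) =>
           if b then Succ (Succ (Two * t)) else Succ (Two * t))%tm Zero w.

Lemma eval_str_term e w : eval e (str_term w) = nat_of_str w.
Proof.
elim/last_ind: w => // w b; rewrite /str_term /nat_of_str !foldl_rcons.
by case: b => /= ->; rewrite ?addn1 ?addn0.
Qed.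

(* s is a prefix of t, z being a variable that occurs neither in s nor in t:
   with k = |z|, hence 1 # z = 2^k, it says that deleting the last k binary
   digits of t + 1 leaves s + 1. *)
Definition Prefix (z : nat) (s t : term) : formula :=
  BEx z (Succ t) ((Succ s * (One ## Var z) <= Succ t)
                  && (Succ t < Succ (Succ s) * (One ## Var z)))%fm.

Definition one_free_var (Phi : formula) : Prop :=
  exists x, fvars Phi =i [:: x].

(* Meaningful only under [one_free_var Phi]. *)
Definition free_var (Phi : formula) : nat := head 0 (fvars Phi).

Definition Phi_sup (Phi : formula) (w : seq bool) : formula :=
  let x := free_var Phi in let y := x.+1 in let z := x.+2 in
  Ex y (All x ((Var y < Var x) ==>
               (Phi ==> ~~ Prefix z (str_term w) (Var x))))%fm.

Definition defined_set (Phi : formula) : set (seq bool) :=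
  [set s | forall e, sat (upd e (free_var Phi) (nat_of_str s)) Phi].

Fixpoint strings (c : nat) : seq (seq bool) :=
  if c is c'.+1
  then [seq false :: w | w <- strings c'] ++ [seq true :: w | w <- strings c']
  else [:: [::]].

(* For u nonempty, k <= trunc_log 2 (size u) iff k <= log2 |u|; no code is a
   prefix of the empty string. *)
Definition starts_with (u : seq bool) (Phi : formula) : Prop :=
  [/\ one_free_var Phi, prefix (code Phi) u
    & size (code Phi) <= trunc_log 2 (size u)].

Definition short_proof (T : set formula) (n : nat) (p : formula) : Prop :=
  exists pi, is_proof T pi p /\ size (proof_code pi) <= trunc_log 2 n.

(* [projT1 (cid h)] is the only formula that u starts with, by
   [code_prefix_free]. *)
Definition g (T : set formula) (u : seq bool) : seq bool :=
  let n := size u in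
  match pselect (exists Phi, starts_with u Phi) with
  | left h =>
      let Phi := projT1 (cid h) in
      let c := (size (code Phi)).+1 in
      let u0 := drop (size (code Phi)) u in
      if ohead [seq w <- strings c | ~~ `[< short_proof T n (Phi_sup Phi w) >]]
        is Some w0
      then w0 ++ u0
      else nseq n.+1 false
  | right _ => nseq n.+1 false
  end.

(* Main.v *)
Require Import Defs.
From mathcomp Require Import all_boot.
From mathcomp Require Import zify.
From mathcomp Require Import boolp classical_sets cardinality.
Set Implicit Arguments.
Unset Strict Implicit.
Local Open Scope classical_set_scope.
Local Open Scope nat_scope.

(** Fix Phi defining A and c = |Phi| + 1. Since T is sound and proves every true
    Phi^w with |w| = c, for inputs of large length n the sentences Phi^w having
    a T-proof of size at most log n are exactly the true ones, so the string
    w_0 selected by g_T does not depend on n: it is the first w for which Phi^w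
    is false. It exists because A is infinite. As Phi^{w_0} is false, A has
    arbitrarily long elements of the form w_0 u_0, and g_T(Phi u_0) = w_0 u_0. *)

(** * Soundness of the calculus *)

Lemma eval_eq_on (e e' : nat -> nat) (t : term) :
  {in tvars t, e =1 e'} -> eval e t = eval e' t.
Proof.
elim: t => [i||s IH|s IH|s IH|s IHs t IHt|s IHs t IHt|s IHs t IHt] //= H.
- by apply: H; rewrite inE.
- by rewrite IH.
- by rewrite IH.
- by rewrite IH.
all: by rewrite IHs ?IHt // => i Hi; apply: H; rewrite mem_cat Hi ?orbT.
Qed.

Lemma sat_eq_on (e e' : nat -> nat) (p : formula) :
  {in fvars p, e =1 e'} -> sat e p <-> sat e' p.
Proof.
have upd_eq_on (f f' : nat -> nat) x q n :
    {in [seq y <- fvars q | y != x], f =1 f'} ->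
    {in fvars q, upd f x n =1 upd f' x n}.
  move=> H y Hy; rewrite /upd; case: eqP => // /eqP yx.
  by apply: H; rewrite mem_filter yx.
elim: p e e' => [s t|s t|q IH|q IHq r IHr|q IHq r IHr|q IHq r IHr|x q IH|x q IH]
  e e' /= H.
1,2: by rewrite (@eval_eq_on e e' s) 1?(@eval_eq_on e e' t) // => i Hi;
  apply: H; rewrite mem_cat Hi ?orbT.
- by rewrite (IH e e').
- by rewrite (IHq e e') ?(IHr e e') // => i Hi; apply: H; rewrite mem_cat Hi ?orbT.
- by rewrite (IHq e e') ?(IHr e e') // => i Hi; apply: H; rewrite mem_cat Hi ?orbT.
- by rewrite (IHq e e') ?(IHr e e') // => i Hi; apply: H; rewrite mem_cat Hi ?orbT.
- by split=> h n; [apply: (IH _ _ (upd_eq_on _ _ _ _ n H)).1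
    | apply: (IH _ _ (upd_eq_on _ _ _ _ n H)).2].
- by split=> -[n h]; exists n; [apply: (IH _ _ (upd_eq_on _ _ _ _ n H)).1
    | apply: (IH _ _ (upd_eq_on _ _ _ _ n H)).2].
Qed.

Lemma sat_upd_notin (e : nat -> nat) (x n : nat) (p : formula) :
  x \notin fvars p -> sat (upd e x n) p <-> sat e p.
Proof.
move=> xp; apply: sat_eq_on => y yp; rewrite /upd; case: eqP => // yx.
by rewrite -yx yp in xp.
Qed.

Lemma eval_tsubst (e : nat -> nat) (x : nat) (t s : term) :
  eval e (tsubst x t s) = eval (upd e x (eval e t)) s.
Proof.
elim: s => [i||s IH|s IH|s IH|s1 IH1 s2 IH2|s1 IH1 s2 IH2|s1 IH1 s2 IH2] //=;
  rewrite ?IH ?IH1 ?IH2 //.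
by rewrite /upd; case: eqP.
Qed.

Lemma tsubst_notin (x : nat) (t s : term) : x \notin tvars s -> tsubst x t s = s.
Proof.
elim: s => [i||s IH|s IH|s IH|s1 IH1 s2 IH2|s1 IH1 s2 IH2|s1 IH1 s2 IH2] //=;
  first by rewrite inE eq_sym => /negPf ->.
1-3: by move=> /IH ->.
all: by rewrite mem_cat negb_or => /andP[/IH1 -> /IH2 ->].
Qed.

Lemma fsubst_notin (x : nat) (t : term) (p : formula) :
  x \notin fvars p -> fsubst x t p = p.
Proof.
elim: p => [s1 s2|s1 s2|q IH|q IHq r IHr|q IHq r IHr|q IHq r IHr|y q IH|y q IH] /=.
1,2: by rewrite mem_cat negb_or => /andP[? ?]; rewrite !tsubst_notin.
- by move=> /IH ->.
1-3: by rewrite mem_cat negb_or => /andP[/IHq -> /IHr ->].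
all: by rewrite mem_filter negb_and negbK eq_sym; case: eqP => //= _ /IH ->.
Qed.

Lemma sat_fsubst (e : nat -> nat) (x : nat) (t : term) (p : formula) :
  free_for t x p -> sat e (fsubst x t p) <-> sat (upd e x (eval e t)) p.
Proof.
(* The updates at x and y commute: y differs from x and, not occurring in t, leaves the value of t
   unchanged. *)
have upd_comm f y q n : y != x -> y \notin tvars t ->
    sat (upd (upd f x (eval f t)) y n) q <->
    sat (upd (upd f y n) x (eval (upd f y n) t)) q.
  move=> yx yt; apply: sat_eq_on => i _.
  have -> : eval (upd f y n) t = eval f t.
    apply: eval_eq_on => j jt; rewrite /upd; case: eqP => // jy.
    by rewrite -jy jt in yt.
  by rewrite /upd; case: eqP => // ->; rewrite (negPf yx).
elim: p e => [s1 s2|s1 s2|q IH|q IHq r IHr|q IHq r IHr|q IHq r IHr|y q IH|y q IH] e.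
1,2: by rewrite /= !eval_tsubst.
- by move=> /= /IH ->.
1-3: by move=> /= /andP[/IHq -> /IHr ->].
(* If x is not free in the quantified formula, [free_for] says nothing about t, but then neither the
   substitution nor the update has any effect. *)
1: have [xp|xp _] := boolP (x \in fvars (All y q)).
3: have [xp|xp _] := boolP (x \in fvars (Ex y q)).
2,4: by rewrite fsubst_notin // sat_upd_notin.
all: move: xp; rewrite /= mem_filter eq_sym => /andP[yx xq];
  rewrite yx xq (negPf yx) /= => /andP[yt ff].
- split=> h n; first by apply/upd_comm => //; apply/IH.
  by apply/IH => //; apply/upd_comm.
- split=> -[n h]; exists n; first by apply/upd_comm => //; apply/IH.
  by apply/IH => //; apply/upd_comm.
Qed.

Lemma logical_axiom_true (p : formula) : logical_axiom p -> true_in_N p.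
Proof.
case=> [{}p q|{}p q r|{}p q|{}p q|{}p q|{}p q|{}p q|{}p q r|{}p q|{}p
  |x t {}p ff|x t {}p ff|t|x s t {}p fs ft] e /=; try tauto.
- exact: contrapT.
- by move=> h; apply/sat_fsubst.
- by move=> /(sat_fsubst _ ff) h; exists (eval e t).
- by move=> st /(sat_fsubst _ fs) h; apply/sat_fsubst; rewrite // -st.
Qed.

(** The invariant is truth under every assignment. The two quantifier rules change the value of x in
    a premise, which q does not notice since x is not free in it. *)
Lemma derivation_true (T : set formula) (pi : seq formula) :
  sound T -> derivation T pi -> {in pi, forall p, true_in_N p}.
Proof.
move=> sT; elim=> [//|prev p _ IH jp q].
rewrite mem_rcons inE => /orP[/eqP ->|]; last exact: IH.
case: jp => {p q} [p /logical_axiom_true //|p /sT //|q p /IH tq /IH tqp e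
  |x q p xq /IH tqp e /= sq n|x q p xq /IH tpq e /= [n sp]].
- exact: tqp (tq e).
- by apply: tqp; apply/sat_upd_notin.
- by have /sat_upd_notin := tpq _ sp; apply.
Qed.

Lemma provable_true (T : set formula) (p : formula) :
  sound T -> provable T p -> true_in_N p.
Proof.
move=> sT [pi [d [prev pi_eq]]]; apply: derivation_true sT d _ _.
by rewrite pi_eq mem_rcons inE eqxx.
Qed.

(** * Strings as numbers *)

(** The successor is the number with binary digits 1w, so appending a bit to w appends a digit;
    hence the successors in the lemmas below. *)
Lemma nat_of_str_rcons (w : seq bool) (b : bool) :
  (nat_of_str (rcons w b)).+1 = 2 * (nat_of_str w).+1 + b.
Proof. by rewrite /nat_of_str foldl_rcons; lia. Qed.

Lemma nat_of_str_inj : injective nat_of_str.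
Proof.
have nil0 : nat_of_str [::] = 0 by [].
elim/last_ind => [|s a IH] t; elim/last_ind: t => [|t b _] // eq_st.
- by have := nat_of_str_rcons t b; rewrite -eq_st nil0; lia.
- by have := nat_of_str_rcons s a; rewrite eq_st nil0; lia.
have := nat_of_str_rcons s a; rewrite eq_st nat_of_str_rcons => eq2.
have -> : a = b by case: a b {eq_st} eq2 => -[] //=; lia.
by congr rcons; apply: IH; lia.
Qed.

Lemma nat_of_str_surj (n : nat) : exists s, nat_of_str s = n.
Proof.
elim/ltn_ind: n => -[|n] IH; first by exists [::].
(* The binary digits of n + 2 are those of n./2 + 1 followed by [odd n]. *)
have [s sE] := IH n./2 ltac:(lia).
by exists (rcons s (odd n)); have := nat_of_str_rcons s (odd n); lia.
Qed.

Lemma nat_of_str_cat (s t : seq bool) :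
  (nat_of_str s).+1 * 2 ^ size t <= (nat_of_str (s ++ t)).+1
    < (nat_of_str s).+2 * 2 ^ size t.
Proof.
elim/last_ind: t => [|t b]; first by rewrite cats0 expn0; lia.
by rewrite -rcons_cat nat_of_str_rcons size_rcons expnS; case: b => /=; lia.
Qed.

(** The case of an empty prefix, whose number is 0. It serves to show that strings with large
    numbers are long. *)
Lemma nat_of_str_lt (s : seq bool) : (nat_of_str s).+1 < 2 ^ (size s).+1.
Proof. by have := nat_of_str_cat [::] s; rewrite expnS /nat_of_str /=; lia. Qed.

(** Deleting the last bit of t lowers k by one, and at k = 0 the two numbers coincide. For k > 0 the
    lower bound is at least 2, so t is not empty. *)
Lemma prefix_nat_of_str (s t : seq bool) (k : nat) :
  (nat_of_str s).+1 * 2 ^ k <= (nat_of_str t).+1 < (nat_of_str s).+2 * 2 ^ k ->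
  prefix s t.
Proof.
elim: k t => [|k IH] t.
  move=> h; suff -> : t = s by exact: prefix_refl.
  by apply: nat_of_str_inj; lia.
rewrite expnS; elim/last_ind: t => [|t b _] h.
  have : 0 < 2 ^ k by rewrite expn_gt0.
  by move: h; rewrite /nat_of_str /=; nia.
apply: prefix_trans (prefix_rcons t b); apply: IH.
by move: h; rewrite nat_of_str_rcons; case: b => /=; lia.
Qed.

Lemma sat_Prefix (e : nat -> nat) (z x : nat) (s t : seq bool) :
  z != x -> e x = nat_of_str t ->
  sat e (Prefix z (str_term s) (Var x)) <-> prefix s t.
Proof.
move=> zx ex; rewrite /=.
have -> : blen 1 = 1 by [].
split.
  move=> [n]; rewrite !eval_str_term /upd eqxx eq_sym (negPf zx) ex mul1n.
  move=> [_ [h1 h2]]; apply: (@prefix_nat_of_str _ _ (blen n)).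
  by apply/andP; split.
(* This number is written with |u| ones, so its length is |u|; it also respects the bound t + 1 on
   the quantifier. *)
move=> /prefixP [u tE]; exists (2 ^ size u).-1.
rewrite !eval_str_term /upd eqxx eq_sym (negPf zx) ex mul1n.
have u0 : 0 < 2 ^ size u by rewrite expn_gt0.
have -> : blen (2 ^ size u).-1 = size u by rewrite /blen prednK // up_expnK.
have /andP[h1 h2] := nat_of_str_cat s u.
rewrite tE; split; last by split.
by apply: leq_trans (leq_pred _) (leq_trans _ h1); rewrite leq_pmull.
Qed.

(** * * Finite enumerations and uniform bounds *)

Lemma mem_strings (c : nat) (w : seq bool) : (w \in strings c) = (size w == c).
Proof.
elim: c w => [|c IH] w /=; first by rewrite inE size_eq0.
rewrite mem_cat; case: w => [|b w] /=.
  by apply/negbTE/negP => /orP[] /mapP [].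
rewrite eqSS -IH; apply/orP/idP; first by case=> /mapP [u uc [_ ->]].
by case: b => wc; [right|left]; apply: map_f.
Qed.

(** Used for the finitely many w of length c: once for the bounds that Phi^w asserts, once for the
    sizes of proofs. *)
Lemma seq_uniform_bound (X : eqType) (P : X -> nat -> Prop) (s : seq X) :
  (forall x m n, m <= n -> P x m -> P x n) ->
  {in s, forall x, exists n, P x n} -> exists n, {in s, forall x, P x n}.
Proof.
move=> mono; elim: s => [|x s IH] H; first by exists 0.
have [n Hn] : exists n, {in s, forall x, P x n}.
  by apply: IH => y ys; apply: H; rewrite inE ys orbT.
have [m Hm] := H x (mem_head _ _).
exists (maxn m n) => y; rewrite inE => /orP[/eqP ->|ys].
- by apply: mono Hm; rewrite leq_maxl.
- by apply: mono (Hn y ys); rewrite leq_maxr.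
Qed.

Lemma infinite_nat_of_str_gt (A : set (seq bool)) (n : nat) :
  infinite_set A -> exists2 s, A s & n < nat_of_str s.
Proof.
move=> Ainf; apply: contrapT => H; apply: Ainf.
apply: (@sub_finite_set _ _ (nat_of_str @^-1` `I_n.+1)).
  by move=> s As /=; rewrite ltnS leqNgt; apply/negP => h; apply: H; exists s.
apply: finite_preimage; last exact: finite_II.
by move=> s t _ _; exact: nat_of_str_inj.
Qed.

(** * The sentences Phi^w *)

Lemma one_free_varE (Phi : formula) :
  one_free_var Phi -> fvars Phi =i [:: free_var Phi].
Proof.
move=> [x xE] y; rewrite xE /free_var.
case E : (fvars Phi) xE => [|z l] xE.
  by have := xE x; rewrite !inE eqxx.
by have := xE z; rewrite !inE eqxx /= => /esym/eqP ->.
Qed.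

Lemma sat_defined_set (Phi : formula) (e : nat -> nat) (s : seq bool) :
  one_free_var Phi -> e (free_var Phi) = nat_of_str s ->
  sat e Phi <-> defined_set Phi s.
Proof.
move=> /one_free_varE xE es.
have sub (f f' : nat -> nat) : f (free_var Phi) = f' (free_var Phi) ->
    sat f Phi -> sat f' Phi.
  by move=> ff' /sat_eq_on; apply => y; rewrite xE inE => /eqP ->.
split=> [h f|/(_ e)]; last by apply: sub; rewrite /upd eqxx es.
by apply: sub h; rewrite /upd eqxx es.
Qed.

Lemma true_Phi_sup (Phi : formula) (w : seq bool) : one_free_var Phi ->
  true_in_N (Phi_sup Phi w) <->
  exists n, forall s, n < nat_of_str s -> defined_set Phi s -> ~~ prefix w s.
Proof.
move=> one; set x := free_var Phi.
(* The bound variables x + 1 and x + 2 are distinct from x, the only free variable of Phi, so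
   binding them does not affect Phi. *)
have xy : x == x.+1 = false by lia.
have zx : x.+2 != x by lia.
have satE f s : f x = nat_of_str s ->
    sat f (Phi ==> ~~ Prefix x.+2 (str_term w) (Var x))%fm <->
    (defined_set Phi s -> ~~ prefix w s).
  move=> fx; have h1 := sat_defined_set one fx; have h2 := sat_Prefix w zx fx.
  split=> h.
    by move=> /h1 /h /= h3; apply/negP => /h2.
  by move=> /h1 /h /negP h3 /h2.
split.
  move=> /(_ (fun=> 0)) [n h]; exists n => s ns.
  apply: (satE (upd (upd (fun=> 0) x.+1 n) x (nat_of_str s)) s _).1.
    by rewrite /upd eqxx.
  by apply: h; rewrite /= /upd !eqxx eq_sym xy.
move=> [n h] e; exists n => m.
have [s <-] := nat_of_str_surj m.
rewrite -/x => /= lt_ns; apply: (satE _ s _).2; first by rewrite /upd eqxx.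
by apply: h; move: lt_ns; rewrite /upd !eqxx eq_sym xy.
Qed.

(* The bounds for the finitely many w of length c would combine to a bound for
   all of A. *)
Lemma false_Phi_sup (Phi : formula) (c : nat) :
  one_free_var Phi -> infinite_set (defined_set Phi) ->
  exists2 w, size w = c & ~ true_in_N (Phi_sup Phi w).
Proof.
move=> one inf; apply: contrapT => H.
have [|w|N HN] := @seq_uniform_bound _ (fun w n => forall s,
    n < nat_of_str s -> defined_set Phi s -> ~~ prefix w s) (strings c).
- by move=> w m n mn h s ns; apply: h; apply: leq_ltn_trans ns.
- rewrite mem_strings => /eqP sw; apply/true_Phi_sup => //.
  by apply: contrapT => nt; apply: H; exists w.
(* The summand N contradicts the uniform bound; the power of 2 forces |s| >= c, so that s has a
   prefix of length c. *)
have [s As Ns] := infinite_nat_of_str_gt (N + 2 ^ c.+1) inf.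
have cs : c <= size s.
  rewrite leqNgt; apply/negP => sc; have := nat_of_str_lt s.
  have : 2 ^ (size s).+1 <= 2 ^ c.+1 by rewrite leq_exp2l // ltnS ltnW.
  by lia.
have /HN : take c s \in strings c by rewrite mem_strings size_takel.
move=> /(_ s) /(_ ltac:(lia) As) /negP; apply.
by apply/prefixP; exists (drop c s); rewrite cat_take_drop.
Qed.

(** * * Values of g_T and the range *)

Lemma g_code_cat (T : set formula) (Phi : formula) (u : seq bool) :
  starts_with (code Phi ++ u) Phi ->
  g T (code Phi ++ u) =
  if ohead [seq w <- strings (size (code Phi)).+1 |
             ~~ `[< short_proof T (size (code Phi ++ u)) (Phi_sup Phi w) >]]
    is Some w0
  then w0 ++ u else nseq (size (code Phi ++ u)).+1 false.
Proof.
move=> st; rewrite /g; case: pselect => [h|]; last by case; exists Phi.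
(* The formula picked by choice is Phi because the code is prefix-free. *)
have -> : projT1 (cid h) = Phi.
  case: (cid h) => Psi /= [_ pre _]; case: st => _ pre' _.
  exact: code_prefix_free pre pre'.
by rewrite drop_size_cat.
Qed.

Theorem theorem2p2 (T : set formula) (A : set (seq bool))
    (hS12 : forall p : formula, S12 p -> provable T p)
    (hsound : sound T)
    (hptime : ptime_decidable (code @` T))
    (hinf : infinite_set A)
    (hA : exists Phi : formula,
      [/\ one_free_var Phi,
          A = defined_set Phi
        & forall w : seq bool, size w = (size (code Phi)).+1 ->
            true_in_N (Phi_sup Phi w) -> provable T (Phi_sup Phi w)]) :
  range (g T) `&` A !=set0.
Proof.
case: hA => Phi [one AE complete]; rewrite {}AE in hinf *.
set c := (size (code Phi)).+1.
(* M bounds the size of some proof of each true Phi^w with |w| = c; a false Phi^w satisfies the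
   implication vacuously. *)
have [||M HM] := @seq_uniform_bound _ (fun w M => true_in_N (Phi_sup Phi w) ->
    exists2 pi, is_proof T pi (Phi_sup Phi w) & size (proof_code pi) <= M)
    (strings c).
- move=> w m n mn h /h [pi p1 p2]; exists pi => //; exact: leq_trans mn.
- move=> w; rewrite mem_strings => /eqP sw.
  have [/(complete _ sw) [pi p1]|nt] := pselect (true_in_N (Phi_sup Phi w)).
    by exists (size (proof_code pi)) => _; exists pi.
  by exists 0.
pose F := [seq w <- strings c | ~~ `[< true_in_N (Phi_sup Phi w) >]].
(* Soundness turns short proofs into truth, and M turns truth into short proofs; F does not mention
   n. *)
have FE n : M <= trunc_log 2 n ->
    [seq w <- strings c | ~~ `[< short_proof T n (Phi_sup Phi w) >]] = F.
  move=> Mn; apply: eq_in_filter => w wc; congr (~~ _); apply/asbool_equiv_eq.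
  split=> [[pi [ppi _]]|tw]; first by apply: provable_true hsound _; exists pi.
  have [pi ppi spi] := HM w wc tw.
  by exists pi; split=> //; exact: leq_trans Mn.
have [w1 sw1 /asboolPn fw1] := @false_Phi_sup Phi c one hinf.
have : w1 \in F by rewrite mem_filter fw1 mem_strings sw1 eqxx.
case F0 : F => [//|w0 F'] _.
have : w0 \in F by rewrite F0 mem_head.
rewrite mem_filter mem_strings => /andP[/asboolPn fw0 /eqP sw0].
(* From length N on, the logarithm is at least M, so [FE] applies, and at least |Phi|, so that step
   (1) of g_T accepts Phi. *)
pose N := 2 ^ maxn M (size (code Phi)).
(* Otherwise the threshold would witness Phi^{w_0}. Its size makes s longer than N. *)
have [s [Ns As]] : exists s, 2 ^ N.+2 < nat_of_str s /\
    (defined_set Phi s /\ prefix w0 s).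
  apply: contrapT => H; apply: fw0; apply/true_Phi_sup => //.
  by exists (2 ^ N.+2) => s Ns As; apply/negP => ps; apply: H; exists s.
case: As => As /prefixP [u sE].
have sN : N < size s.
  rewrite ltnNge; apply/negP => sN; have := nat_of_str_lt s.
  have : 2 ^ (size s).+1 <= 2 ^ N.+2 by rewrite leq_exp2l // !ltnS ltnW // ltnS.
  by lia.
(* Replacing w_0 by the code of Phi shortens s by exactly one bit, hence the strict bound N < |s|
   before. *)
have uN : N <= size (code Phi ++ u).
  by move: sN; rewrite sE !size_cat sw0 /c addSn ltnS.
have logN : maxn M (size (code Phi)) <= trunc_log 2 (size (code Phi ++ u)).
  by rewrite -[X in X <= _](@trunc_expnK 2) //; apply: leq_trunc_log.
move: logN; rewrite geq_max => /andP[Mu cu].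
exists s; split=> //; exists (code Phi ++ u) => //.
by rewrite g_code_cat ?FE ?F0 ?sE //; split=> //; apply: prefix_prefix.
Qed.
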